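(* Let $N\ge 3$ and let $\vec x=(x_1,\dots,x_N)$ be an $N$-qubit W-class state. Let $P_{tot}$ be the supremum, over LOCC protocols, of the total probability of obtaining a maximally entangled two-qubit state between some pair of parties (all others in a product state), and for a party $k$ let $P_k$ be the supremum over LOCC protocols of the total probability that party $k$ ends up sharing such a maximally entangled state with some other party. Then (I) $P_{tot}\le\kappa(\vec x)$; (II) $P_k\le 2x_k$ if $x_k<x_l$ for some $l$, and $P_k\le 2\eta(\vec x)$ if $x_k\ge x_l$ for all $l$. If moreover $x_0=0$, then $P_{tot}=\kappa(\vec x)$ (the bound in (I) can be approached arbitrarily closely by LOCC protocols), and the bound in (II) is attained exactly by some LOCC protocol.
   Context: An $N$-qubit W-class state is $\sqrt{x_0}|00\cdots0\rangle+\sqrt{x_1}|10\cdots0\rangle+\cdots+\sqrt{x_N}|0\cdots01\rangle$ with $x_i\ge0$, $x_0=1-\sum_{i=1}^Nx_i$, identified with $\vec x=(x_1,\dots,x_N)$. With indices $\{n_1,\dots,n_N\}=\{1,\dots,N\}$ such that $x_{n_1}\ge\cdots\ge x_{n_N}$, define $\eta(\vec x)=x_{n_1}-\big(\frac{1}{x_{n_1}}\big)^{N-2}\prod_{i=2}^N(x_{n_1}-x_{n_i})$ and $\kappa(\vec x)=\sum_{i=2}^N x_{n_i}+\eta(\vec x)$. LOCC denotes local operations and classical communication. *)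

(* Defs.v *)
(* R : realType (the real numbers), C := R[i] (complex numbers
   from mathcomp-real-closed), finite-dimensional LOCC protocols as finite trees. *)
From HB Require Import structures.
From mathcomp Require Import all_boot all_order all_algebra.
From mathcomp Require Import reals.
From mathcomp Require Import complex.
From Stdlib Require Import ClassicalEpsilon.
Set Implicit Arguments. Unset Strict Implicit. Unset Printing Implicit Defensive.
Import Order.TTheory GRing.Theory Num.Theory.
Local Open Scope ring_scope.
Local Open Scope complex_scope.

Section LOCC.
Variables (R : realType) (N D : nat).
Local Notation C := R[i].

(** Computational basis labels of the global space (C^D)^{(x) N}:
    one local basis label in 'I_D for each party in 'I_N. *)
Definition idx := {ffun 'I_N -> 'I_D}.

(** (Unnormalized) pure global states. *)
Definition gstate := idx -> C.

Definition norm2 (psi : gstate) : C := \sum_(a : idx) psi a * (psi a)^*.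

(** Local operator M acting on the tensor factor of party k: (M_k (x) Id) psi. *)
Definition apply_local (k : 'I_N) (M : 'M[C]_D) (psi : gstate) : gstate :=
  fun a => \sum_(j : 'I_D) M (a k) j * psi [ffun l => if l == k then j else a l].

(** Finite-round LOCC protocol: at each node one party k performs a local
    (fine-grained) instrument with Kraus operators M_0..M_{n-1}, broadcasts the
    outcome, and the rest of the protocol depends on the outcome. *)
Inductive protocol : Type :=
| Leaf : protocol
| Node (k : 'I_N) (n : nat) (M : 'I_n -> 'M[C]_D) (next : 'I_n -> protocol).

Definition adjmx (A : 'M[C]_D) : 'M[C]_D := (map_mx (fun z : C => z^*) A)^T.

(** Every instrument is trace preserving: sum_j M_j^dagger M_j = Id. *)
Fixpoint valid (T : protocol) : Prop :=
  match T with
  | Leaf => True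
  | Node _ n M next =>
      \sum_(j < n) adjmx (M j) *m M j = 1%:M /\ forall j, valid (next j)
  end.

(** Total probability that the protocol, started on the (unnormalized) state
    psi, ends in a branch whose state satisfies S. *)
Fixpoint succ_prob (S : gstate -> Prop) (T : protocol) (psi : gstate) : C :=
  match T with
  | Leaf => if excluded_middle_informative (S psi) then norm2 psi else 0
  | Node k n M next =>
      \sum_(j < n) succ_prob S (next j) (apply_local k (M j) psi)
  end.

(** psi is (a multiple of) a two-qubit maximally entangled state between
    parties i and j, tensored with a product state of all other parties:
    psi = c (u1 (x) v1 + u2 (x) v2)_{ij} (x) (x)_{l<>i,j} a_l with
    {u1,u2} and {v1,v2} orthonormal. *)
Definition orthonormal2 (u1 u2 : 'I_D -> C) : Prop :=
  \sum_d u1 d * (u1 d)^* = 1 /\ \sum_d u2 d * (u2 d)^* = 1 /\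
  \sum_d u1 d * (u2 d)^* = 0.

Definition EPR_between (psi : gstate) (i j : 'I_N) : Prop :=
  i != j /\
  exists (u1 u2 v1 v2 : 'I_D -> C) (a : 'I_N -> 'I_D -> C),
    orthonormal2 u1 u2 /\ orthonormal2 v1 v2 /\
    forall b : idx, psi b =
      (u1 (b i) * v1 (b j) + u2 (b i) * v2 (b j)) *
      \prod_(l | (l != i) && (l != j)) a l (b l).

(** Success for P_tot: EPR pair between some pair of parties. *)
Definition EPR_some (psi : gstate) : Prop := exists i j, EPR_between psi i j.

(** Success for P_k: party k shares an EPR pair with some other party. *)
Definition EPR_with (k : 'I_N) (psi : gstate) : Prop :=
  exists j, EPR_between psi k j.

End LOCC.

Arguments Leaf {R N D}.

Section WClass.
Variables (R : realType) (N : nat).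
Local Notation C := R[i].

Definition x0 (x : 'I_N -> R) : R := 1 - \sum_i x i.

Definition Wclass (x : 'I_N -> R) : Prop :=
  (forall i, 0 <= x i) /\ \sum_i x i <= 1.

(** The W-class state sqrt(x0)|0..0> + sum_k sqrt(x_k)|0..1_k..0>, embedded in
    (C^{D+2})^{(x) N} via the first two basis vectors of each local space. *)
Definition Wstate (D : nat) (x : 'I_N -> R) : gstate R N D.+2 :=
  fun b =>
    (if b == [ffun _ => ord0] then (Num.sqrt (x0 x))%:C else 0) +
    \sum_k (if b == [ffun l => if l == k then inord 1 else ord0]
            then (Num.sqrt (x k))%:C else 0).

(** x_{n_1} >= ... >= x_{n_N}: the coordinates sorted non-increasingly. *)
Definition xsorted (x : 'I_N -> R) : seq R :=
  sort (fun a b : R => b <= a) [seq x i | i <- enum 'I_N].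

Definition etaW (x : 'I_N -> R) : R :=
  let s := xsorted x in
  let m := nth 0 s 0 in
  m - (m^-1) ^+ (N - 2) * \prod_(1 <= i < N) (m - nth 0 s i).

Definition kappaW (x : 'I_N -> R) : R :=
  let s := xsorted x in
  \sum_(1 <= i < N) nth 0 s i + etaW x.

End WClass.

Arguments Wstate {R N} D x _.

(* Main.v *)
(* For a party k put mono k x = x_k (1 - prod_{l != k} max(0, 1 - x_l / x_k)). When a party
   measures, every branch multiplies its own coordinate by some c_j and all the others by some
   a_j, where the a_j and the c_j sum to 1. As a function of (a, c), mono k is superadditive
   (it is the perspective of a concave function), so it does not increase on average. On an EPR
   pair involving k it is at least half of the squared norm, whence P_k <= 2 mono k x, and
   P_tot <= sum_k mono k x. Finally mono k x <= x_k, with mono k x = eta x at a maximal x_k.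
   Coordinates are computed from any decomposition of the state as a superposition of product
   states f_1 ... g_k ... f_N, so the local frames need not be orthonormalized.

   Conversely, a party l measuring (p_l, 1) / (1 - p_l, 0) with p_l = x_l / max x is either tied
   with the maximal party or dropped, and neither branch loses anything. In a tie with k, the
   others disentangle themselves and an EPR pair is left. For P_tot all non-maximal parties are
   treated in this way, and the resulting symmetric W states are distilled by rounds of weak
   measurements: a round of strength e loses only the branch in which a single party is left,
   of probability O(e^2). *)
Require Import Defs.
From HB Require Import structures.
From mathcomp Require Import all_boot all_order all_algebra.
From mathcomp Require Import reals complex.
From mathcomp Require Import ring lra.
From mathcomp Require classical_sets.
From Stdlib Require Import FunctionalExtensionality ClassicalEpsilon.
Import Order.TTheory GRing.Theory Num.Theory.
Local Open Scope ring_scope.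
Local Open Scope complex_scope.
Set Implicit Arguments. Unset Strict Implicit. Unset Printing Implicit Defensive.

(** * Superadditive functionals of the coordinates *)

Section Monotone.
Variables (R : realFieldType) (I : finType).
Implicit Types (x z : I -> R) (k l : I).

(** At [x k = 0] the convention for division makes this 1; [mono] multiplies the product by [x k],
    so it is then 0. *)
Definition excess x k l : R := Num.max 0 (1 - x l / x k).

Definition mono k x : R := x k - x k * \prod_(l | l != k) excess x k l.

Definition scl k (a c : R) z : I -> R := fun l => (if l == k then c else a) * z l.

Lemma excess_ge0 x k l : 0 <= excess x k l.
Proof. by rewrite /excess le_max lexx. Qed.

Lemma excess_le1 x k l : (forall i, 0 <= x i) -> excess x k l <= 1.
Proof.
by move=> x0; rewrite /excess ge_max ler01 /= lerBlDr lerDl divr_ge0.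
Qed.

Lemma prod_excess_itv x k (P : pred I) : (forall i, 0 <= x i) ->
  0 <= \prod_(l | P l) excess x k l <= 1.
Proof.
move=> x0; apply/andP; split; first by apply: prodr_ge0 => l _; exact: excess_ge0.
by apply: prodr_ile1 => l; rewrite excess_ge0 excess_le1.
Qed.

Lemma mono_ge0 k x : (forall i, 0 <= x i) -> 0 <= mono k x.
Proof.
move=> x0; have /andP[_ h] := prod_excess_itv k (fun l => l != k) x0.
by rewrite /mono -{1}[x k]mulr1 -mulrBr mulr_ge0 ?subr_ge0.
Qed.

Lemma mono_le k x : (forall i, 0 <= x i) -> mono k x <= x k.
Proof.
move=> x0; have /andP[h _] := prod_excess_itv k (fun l => l != k) x0.
by rewrite /mono lerBlDr lerDl mulr_ge0.
Qed.

Lemma mulr_excess x k l : (forall i, 0 <= x i) ->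
  x k * excess x k l = x k - Num.min (x k) (x l).
Proof.
move=> x0; rewrite /excess; have [->|xk0] := eqVneq (x k) 0.
  by rewrite mul0r min_l // subrr.
have xk : 0 < x k by rewrite lt_neqAle eq_sym xk0 x0.
rewrite maxr_pMr ?x0 // mulr0 mulrBr mulr1 mulrCA mulfV // mulr1.
case: (leP (x k) (x l)) => h; first by rewrite subrr max_l // subr_le0.
by rewrite max_r // subr_ge0 ltW.
Qed.

(** All factors other than that of [l] are at most 1. This is the form needed on an EPR pair, where
    both ends have large coordinates. *)
Lemma min_le_mono x k l : (forall i, 0 <= x i) -> l != k ->
  Num.min (x k) (x l) <= mono k x.
Proof.
move=> x0 lk; rewrite /mono (bigD1 l) //= mulrA mulr_excess //.
have /andP[h0 h1] := prod_excess_itv k (fun i => (i != k) && (i != l)) x0.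
set m := Num.min _ _; set p := \prod_(_ | _) _ in h0 h1 *.
have : m <= x k by rewrite /m ge_min lexx.
by move=> mk; nra.
Qed.

Lemma mono_argmax x k : (forall l, 0 <= x l <= x k) ->
  mono k x = x k - x k * \prod_(l | l != k) (1 - x l / x k).
Proof.
move=> xk; rewrite /mono; congr (_ - _ * _); apply: eq_bigr => l _.
rewrite /excess max_r //; have /andP[l0 lk] := xk l.
have [->|xk0] := eqVneq (x k) 0; first by rewrite invr0 mulr0 subr0.
have xk1 : 0 < x k by rewrite lt_neqAle eq_sym xk0 (le_trans l0).
by rewrite subr_ge0 ler_pdivrMr // mul1r.
Qed.

Lemma scl_ge0 k a c z : 0 <= a -> 0 <= c -> (forall i, 0 <= z i) ->
  forall i, 0 <= scl k a c z i.
Proof. by move=> a0 c0 z0 i; rewrite /scl; case: ifP => _; rewrite mulr_ge0. Qed.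

(** When another party [m] measures, the ratios z_l / z_k with l different from [k] and [m] do not
    change, so only the factor of [m] depends on [a] and [c], through a minimum. *)
Lemma mono_scl_neq k m a c z : m != k -> 0 <= a -> 0 <= c -> (forall i, 0 <= z i) ->
  mono k (scl m a c z) = a * z k -
   (a * z k - Num.min (a * z k) (c * z m)) * \prod_(l | (l != k) && (l != m)) excess z k l.
Proof.
move=> mk a0 c0 z0; rewrite /mono (bigD1 m) //= mulrA mulr_excess; last exact: scl_ge0.
rewrite /scl eqxx [k == m]eq_sym (negPf mk).
have [->|a1] := eqVneq a 0.
  by rewrite !mul0r min_l ?mulr_ge0 // subrr !mul0r.
congr (_ - _ * _); apply: eq_bigr => l /andP[lk lm].
by rewrite /excess (negPf lm) eq_sym (negPf mk) -mulf_div divff // mul1r.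
Qed.

(** A weighted Chebyshev inequality: [g] and [h] are ordered the same way at every index, and so are
    their partial products, which the induction carries along. *)
Lemma prod_weighted_convex (P : pred I) (f g h : I -> R) (s t : R) :
  0 <= s -> 0 <= t ->
  (forall i, 0 <= f i /\ (s + t) * f i <= s * g i + t * h i) ->
  (forall i, 0 <= g i <= h i) ->
  (s + t) * \prod_(i | P i) f i <= s * \prod_(i | P i) g i + t * \prod_(i | P i) h i.
Proof.
move=> s0 t0 fc gh.
suff [] : 0 <= \prod_(i | P i) f i /\ (0 <= \prod_(i | P i) g i <= \prod_(i | P i) h i) /\
  (s + t) * \prod_(i | P i) f i <= s * \prod_(i | P i) g i + t * \prod_(i | P i) h i.
  by move=> _ [].
have [/eqP|st0] := eqVneq (s + t) 0.
  rewrite paddr_eq0 // => /andP[/eqP-> /eqP->]; rewrite addr0 !mul0r addr0; split.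
    by apply: prodr_ge0 => i _; have [] := fc i.
  split=> //; rewrite prodr_ge0 ?ler_prod // => i _; by have /andP[] := gh i.
have {st0} st : 0 < s + t by rewrite lt_neqAle eq_sym st0 addr_ge0.
apply: (big_rec3 (fun a b c => 0 <= a /\ (0 <= b <= c) /\ (s + t) * a <= s * b + t * c)).
  by rewrite !mulr1 ler01 lexx.
move=> i a b c _ [a0 [/andP[b0 bc] abc]]; have [f0 fi] := fc i; have /andP[g0 ghi] := gh i.
split; first exact: mulr_ge0.
split; first by rewrite mulr_ge0 //= ler_pM.
rewrite -(ler_pM2l st).
have h1 : ((s + t) * f i) * ((s + t) * a) <= (s * g i + t * h i) * (s * b + t * c).
  by apply: ler_pM => //; rewrite mulr_ge0 // ltW.
(* This is exactly the gap between (s + t)(s g b + t h c) and (s g + t h)(s b + t c). *)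
have h2 : 0 <= s * t * ((h i - g i) * (c - b)) by rewrite !mulr_ge0 // subr_ge0.
apply: le_trans (le_trans h1 _); first by rewrite le_eqVlt; apply/orP; left; apply/eqP; ring.
by rewrite -subr_ge0; move: h2; congr (_ <= _); ring.
Qed.

(** If [m] differs from [k], superadditivity of the minimum suffices. If [k] itself measures, each
    factor weighted by [x k] is subadditive, and the factors are combined by
    [prod_weighted_convex]. *)
Lemma mono_scl_superadd k m a1 c1 a2 c2 z :
  0 <= a1 -> 0 <= c1 -> 0 <= a2 -> 0 <= c2 -> (forall i, 0 <= z i) ->
  mono k (scl m a1 c1 z) + mono k (scl m a2 c2 z) <= mono k (scl m (a1 + a2) (c1 + c2) z).
Proof.
move=> a10 c10 a20 c20 z0.
have min_add (s1 t1 s2 t2 : R) :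
    Num.min s1 t1 + Num.min s2 t2 <= Num.min (s1 + s2) (t1 + t2).
  by rewrite le_min; apply/andP; split; apply: lerD; rewrite ge_min lexx ?orbT.
have [mk|mk] := eqVneq m k; last first.
  rewrite !mono_scl_neq ?addr_ge0 //.
  have /andP[q0 q1] := prod_excess_itv k (fun l => (l != k) && (l != m)) z0.
  set q := \prod_(_ | _) _ in q0 q1 *.
  rewrite !mulrDl; have := min_add (a1 * z k) (c1 * z m) (a2 * z k) (c2 * z m).
  set p1 := Num.min (a1 * z k) _; set p2 := Num.min (a2 * z k) _; set p := Num.min (_ + _) _.
  by move=> h; nra.
subst m; set x1 := scl k a1 c1 z; set x2 := scl k a2 c2 z; set x := scl k _ _ z.
have x10 : forall i, 0 <= x1 i by exact: scl_ge0.
have x20 : forall i, 0 <= x2 i by exact: scl_ge0.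
have x0 : forall i, 0 <= x i by apply: scl_ge0; rewrite ?addr_ge0.
have xE i : x i = x1 i + x2 i by rewrite /x /x1 /x2 /scl; case: ifP; rewrite mulrDl.
have cvx l : (x1 k + x2 k) * excess x k l <= x1 k * excess x1 k l + x2 k * excess x2 k l.
  rewrite -xE !mulr_excess //.
  by have := min_add (x1 k) (x1 l) (x2 k) (x2 l); rewrite !xE; lra.
suff main : x k * \prod_(l | l != k) excess x k l <=
    x1 k * \prod_(l | l != k) excess x1 k l + x2 k * \prod_(l | l != k) excess x2 k l.
  by move: main; rewrite /mono xE; lra.
(* For l <> k the excess depends on z_l only through the slope a / (c z_k), so the smaller
   slope gives the larger factor for all l at once: Chebyshev's inequality applies. *)
have exE a c l : l != k ->
    excess (scl k a c z) k l = Num.max 0 (1 - a / (c * z k) * z l).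
  by move=> lk; rewrite /excess /scl eqxx (negPf lk) mulrAC.
have mon r1 r2 l : r1 <= r2 -> Num.max 0 (1 - r2 * z l) <= Num.max 0 (1 - r1 * z l).
  by move=> h; rewrite ge_max !le_max lexx lerD2l lerN2 ler_wpM2r // orbT.
(* The value 1 at [k] leaves the products unchanged and makes the hypotheses of
   [prod_weighted_convex] hold at every index. *)
pose e y l := if l == k then 1 else excess y k l.
have eP y : \prod_(l | l != k) excess y k l = \prod_(l | l != k) e y l.
  by apply: eq_bigr => l /negPf lk; rewrite /e lk.
have e0 y l : 0 <= e y l by rewrite /e; case: ifP => // _; exact: excess_ge0.
have ecvx l : (x1 k + x2 k) * e x l <= x1 k * e x1 l + x2 k * e x2 l.
  by rewrite /e; case: ifP => // _; rewrite !mulr1.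
rewrite !eP xE.
have [r12|/ltW r12] := leP (a2 / (c2 * z k)) (a1 / (c1 * z k)).
  apply: prod_weighted_convex => // l; rewrite e0 /=.
  by rewrite /e; case: ifPn => // lk; rewrite !exE // mon.
rewrite addrC [leRHS]addrC; apply: prod_weighted_convex => // l; rewrite e0 /=.
  by rewrite addrC [leRHS]addrC.
by rewrite /e; case: ifPn => // lk; rewrite !exE // mon.
Qed.

Lemma mono_scl_sum k m n (a c : 'I_n -> R) z :
  (forall j, 0 <= a j) -> (forall j, 0 <= c j) -> (forall i, 0 <= z i) ->
  \sum_j mono k (scl m (a j) (c j) z) <= mono k (scl m (\sum_j a j) (\sum_j c j) z).
Proof.
move=> a0 c0 z0.
suff [_ []] : 0 <= \sum_j a j /\ 0 <= \sum_j c j /\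
  \sum_j mono k (scl m (a j) (c j) z) <= mono k (scl m (\sum_j a j) (\sum_j c j) z) by [].
apply: (big_rec3 (fun p q r => 0 <= q /\ 0 <= p /\ r <= mono k (scl m q p z))).
  by rewrite lexx mono_ge0 //; apply: scl_ge0.
move=> j p q r _ [q0 [p0 h]]; rewrite !addr_ge0 //; split=> //; split=> //.
by apply: le_trans (mono_scl_superadd _ _ _ _ _ _ _); rewrite ?lerD2l.
Qed.

End Monotone.

(** * Product states and local operations *)

Section ProductStates.
Variables (R : realType) (N D : nat).
Local Notation C := R[i].
Local Notation vec := ('I_D -> C).
Local Notation state := (gstate R N D).
Implicit Types (u v w : vec) (f g p : 'I_N -> vec) (M : 'M[C]_D) (k : 'I_N).

Definition normsq (z : C) : R := complex.Re z ^+ 2 + complex.Im z ^+ 2.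

Lemma mul_conjc z : z * z^* = (normsq z)%:C.
Proof.
case: z => a b; apply/eqP; rewrite eq_complex /normsq /=.
by apply/andP; split; apply/eqP; ring.
Qed.

Lemma normsq_ge0 z : 0 <= normsq z.
Proof. by rewrite addr_ge0 // sqr_ge0. Qed.

Lemma normsqM y z : normsq (y * z) = normsq y * normsq z.
Proof. by case: y => a b; case: z => c d; rewrite /normsq /=; ring. Qed.

Lemma normsq_eq0 z : (normsq z == 0) = (z == 0).
Proof. by case: z => a b; rewrite /normsq paddr_eq0 ?sqr_ge0 // !sqrf_eq0 eq_complex. Qed.

Definition dotp u v : C := \sum_d u d * (v d)^*.

Definition vnormsq v : R := \sum_d normsq (v d).

Lemma dotpE v : dotp v v = (vnormsq v)%:C.
Proof. by rewrite /dotp /vnormsq rmorph_sum; apply: eq_bigr => d _; rewrite mul_conjc. Qed.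

Lemma vnormsq_ge0 v : 0 <= vnormsq v.
Proof. by apply: sumr_ge0 => d _; exact: normsq_ge0. Qed.

Lemma vnormsqZ z v : vnormsq (fun d => z * v d) = normsq z * vnormsq v.
Proof. by rewrite /vnormsq mulr_sumr; apply: eq_bigr => d _; rewrite normsqM. Qed.

Lemma dotpC u v : dotp v u = ((dotp u v)^*)%R.
Proof. by rewrite /dotp rmorph_sum; apply: eq_bigr => d _; rewrite rmorphM /= conjCK mulrC. Qed.

Lemma cauchy_schwarz u v : normsq (dotp u v) <= vnormsq u * vnormsq v.
Proof.
have [v0|v0] := eqVneq (vnormsq v) 0.
  suff -> : dotp u v = 0 by rewrite v0 mulr0 /normsq /= expr0n addr0.
  rewrite /dotp big1 // => d _.
  have : \sum_d normsq (v d) == 0 by rewrite -/(vnormsq v) v0.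
  rewrite psumr_eq0 => [/allP/(_ d)|]; last by move=> *; exact: normsq_ge0.
  by rewrite mem_index_enum /= normsq_eq0 => /(_ isT)/eqP ->; rewrite rmorph0 mulr0.
have vp : 0 < vnormsq v by rewrite lt_neqAle eq_sym v0 vnormsq_ge0.
have [t tE] : exists t, t = dotp u v by exists (dotp u v).
have [s sE] : exists s, s = vnormsq v by exists (vnormsq v).
have conj_s : (s%:C^*)%R = s%:C by exact: conjc_real.
(* The usual vector |v|^2 u - <u,v> v, whose squared norm is nonnegative. *)
have key : (vnormsq (fun d => s%:C * u d - t * v d))%:C = (s * (s * vnormsq u - normsq t))%:C.
  rewrite -dotpE.
  transitivity (s%:C * s%:C * dotp u u - s%:C * t^* * dotp u v - s%:C * t * dotp v u +
                t * t^* * dotp v v).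
    rewrite /dotp !mulr_sumr -!sumrB -big_split /=; apply: eq_bigr => d _.
    by rewrite rmorphB !rmorphM /= conj_s; ring.
  rewrite !dotpE (dotpC u v) -tE -sE rmorphM rmorphB rmorphM /= -mul_conjc.
  by ring.
have : 0 <= s * (s * vnormsq u - normsq t) by rewrite -(complexI key) vnormsq_ge0.
by rewrite pmulr_rge0 ?sE // subr_ge0 mulrC tE.
Qed.

Definition actv M v : vec := fun d => \sum_e M d e * v e.

(** Applied to [f k] and to [g k], this says that the weights of the branches of a measurement add
    up to the original ones. *)
Lemma kraus_vnormsq n (M : 'I_n -> 'M[C]_D) v :
  \sum_j adjmx (M j) *m M j = 1%:M -> \sum_j vnormsq (actv (M j) v) = vnormsq v.
Proof.
move=> hM; apply: (@complexI R); rewrite rmorph_sum /= -dotpE.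
pose c : 'cV[C]_D := \col_d v d.
have adjE (A : 'M[C]_D) : dotp (actv A v) (actv A v) =
    ((map_mx conjc c)^T *m (adjmx A *m A) *m c) 0 0.
  rewrite /adjmx !mulmxA -trmx_mul -map_mxM -mulmxA mxE /dotp; apply: eq_bigr => d _.
  by rewrite !mxE mulrC rmorph_sum /=; congr (_ * _); [rewrite -rmorph_sum /=; congr (_ ^*)|];
    apply: eq_bigr => e _; rewrite !mxE.
transitivity (\sum_j ((map_mx conjc c)^T *m (adjmx (M j) *m M j) *m c) 0 0).
  by apply: eq_bigr => j _; rewrite -adjE dotpE.
rewrite -summxE -mulmx_suml -mulmx_sumr hM mulmx1 mxE /dotp.
by apply: eq_bigr => d _; rewrite !mxE mulrC.
Qed.

Definition prodst p : state := fun b => \prod_l p l (b l).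

Definition setf (T : Type) (p : 'I_N -> T) k (v : T) : 'I_N -> T :=
  fun l => if l == k then v else p l.

Lemma setf_at T (p : 'I_N -> T) k (x : T) : setf p k x k = x.
Proof. by rewrite /setf eqxx. Qed.

Lemma setf_same T (p : 'I_N -> T) k (x y : T) : setf (setf p k x) k y = setf p k y.
Proof. by apply: functional_extensionality => l; rewrite /setf; case: (l == k). Qed.

Lemma setf_comm T (p : 'I_N -> T) k m (x y : T) : k != m ->
  setf (setf p k x) m y = setf (setf p m y) k x.
Proof.
move=> km; apply: functional_extensionality => l; rewrite /setf.
by case: eqP => // ->; rewrite eq_sym (negPf km).
Qed.

Lemma apply_local_prodst k M p :
  apply_local k M (prodst p) = prodst (setf p k (actv M (p k))).
Proof.
apply: functional_extensionality => b; rewrite /apply_local /prodst [RHS](bigD1 k) //=.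
rewrite /setf eqxx mulr_suml; apply: eq_bigr => j _.
rewrite (bigD1 k) //= ffunE eqxx mulrA; congr (_ * _).
by apply: eq_bigr => l /negPf lk; rewrite ffunE lk.
Qed.

Lemma apply_localD k M (psi phi : state) :
  apply_local k M (fun b => psi b + phi b) =
  fun b => apply_local k M psi b + apply_local k M phi b.
Proof.
apply: functional_extensionality => b; rewrite /apply_local -big_split /=.
by apply: eq_bigr => j _; rewrite mulrDr.
Qed.

Lemma apply_localZ k M z (psi : state) :
  apply_local k M (fun b => z * psi b) = fun b => z * apply_local k M psi b.
Proof.
apply: functional_extensionality => b; rewrite /apply_local mulr_sumr.
by apply: eq_bigr => j _; rewrite mulrCA.
Qed.

Lemma apply_local_sum k M (psi : 'I_N -> state) :
  apply_local k M (fun b => \sum_m psi m b) = fun b => \sum_m apply_local k M (psi m) b.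
Proof.
apply: functional_extensionality => b; rewrite /apply_local exchange_big /=.
by apply: eq_bigr => j _; rewrite mulr_sumr.
Qed.

Definition inner (psi phi : state) : C := \sum_b psi b * (phi b)^*.

Lemma inner_prodst p q : inner (prodst p) (prodst q) = \prod_l dotp (p l) (q l).
Proof.
rewrite /inner /dotp bigA_distr_bigA; apply: eq_bigr => b _.
by rewrite /prodst rmorph_prod -big_split.
Qed.

Lemma norm2_prodst p : norm2 (prodst p) = (\prod_l vnormsq (p l))%:C.
Proof. by rewrite [LHS]inner_prodst rmorph_prod; apply: eq_bigr => l _; exact: dotpE. Qed.

Lemma norm2_ge0 (psi : state) : 0 <= norm2 psi.
Proof. by apply: sumr_ge0 => b _; rewrite mul_conjc lecR normsq_ge0. Qed.

(* Superposition of the product state of the f's with the states in which one f k is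
   replaced by g k; W-class states are of this form, with no orthogonality assumed. *)
Definition wrep (c0 : C) f g : state :=
  fun b => c0 * prodst f b + \sum_k prodst (setf f k (g k)) b.

Lemma apply_local_wrep k M c0 f g :
  apply_local k M (wrep c0 f g) =
  wrep c0 (setf f k (actv M (f k))) (setf g k (actv M (g k))).
Proof.
rewrite /wrep apply_localD apply_localZ apply_local_sum apply_local_prodst.
apply: functional_extensionality => b; congr (_ + _); apply: eq_bigr => m _.
rewrite apply_local_prodst; congr (prodst _ b); have [->|mk] := eqVneq m k.
  by rewrite !setf_same /setf eqxx.
by rewrite setf_comm // /setf (negPf mk) eq_sym (negPf mk).
Qed.

(** The squared norm of the product term in which party [k] carries [g k]. *)
Definition wcoord f g k : R := vnormsq (g k) * \prod_(l | l != k) vnormsq (f l).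

Lemma wcoord_ge0 f g k : 0 <= wcoord f g k.
Proof. by rewrite mulr_ge0 ?vnormsq_ge0 // prodr_ge0 // => l _; exact: vnormsq_ge0. Qed.

(** Here [z] is what remains of the coordinates once both vectors of party [k] are factored out; it
    is common to all branches of a measurement by [k]. *)
Lemma wcoord_setf k f g : exists2 z : 'I_N -> R, (forall l, 0 <= z l) & forall u v,
  wcoord (setf f k u) (setf g k v) = scl k (vnormsq u) (vnormsq v) z.
Proof.
exists (fun l => if l == k then \prod_(m | m != k) vnormsq (f m)
                 else vnormsq (g l) * \prod_(m | (m != l) && (m != k)) vnormsq (f m)).
  move=> l; case: ifP => _; last apply: mulr_ge0 (vnormsq_ge0 _) _;
    by apply: prodr_ge0 => m _; exact: vnormsq_ge0.
move=> u v; apply: functional_extensionality => l; rewrite /wcoord /scl.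
rewrite {1}/setf; case: eqVneq => [->|lk].
  by congr (_ * _); apply: eq_bigr => m /negPf mk; rewrite /setf mk.
rewrite (bigD1 k) 1?eq_sym //= {1}/setf eqxx mulrCA; congr (_ * (_ * _)).
by apply: eq_bigr => m /andP[_ /negPf mk]; rewrite /setf mk.
Qed.

Lemma setf_id (T : Type) (p : 'I_N -> T) k : setf p k (p k) = p.
Proof. by apply: functional_extensionality => l; rewrite /setf; case: eqP => // ->. Qed.

(** Induction on the protocol, for all frames at once since each branch changes them. It serves P_k
    with [c = 2] and a single party, and P_tot with [c = 1] and all parties. *)
Lemma succ_prob_le_mono (S : state -> Prop) (P : pred 'I_N) (c : R) : 0 <= c ->
  (forall c0 f g, S (wrep c0 f g) ->
     norm2 (wrep c0 f g) <= (c * \sum_(k | P k) mono k (wcoord f g))%:C) ->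
  forall T, valid T -> forall c0 f g,
  succ_prob S T (wrep c0 f g) <= (c * \sum_(k | P k) mono k (wcoord f g))%:C.
Proof.
move=> cge0 leafP; elim=> [_ c0 f g|k n M next IH [hM hnext] c0 f g] /=.
  case: (excluded_middle_informative (S (wrep c0 f g))) => [h|h] /=; first exact: leafP.
  rewrite lecR mulr_ge0 //; apply: sumr_ge0 => k _; apply: mono_ge0; exact: wcoord_ge0.
have [z z0 zE] := wcoord_setf k f g.
pose a j := vnormsq (actv (M j) (f k)); pose e j := vnormsq (actv (M j) (g k)).
apply: (@le_trans _ _ (\sum_(j < n) (c * \sum_(m | P m) mono m (scl k (a j) (e j) z))%:C)).
  apply: ler_sum => j _; rewrite apply_local_wrep -zE; exact: (IH j (hnext j)).
rewrite -rmorph_sum lecR -mulr_sumr ler_wpM2l // exchange_big /=.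
apply: ler_sum => m _; apply: (le_trans (mono_scl_sum _ _ _ _ z0)) => [j|j|].
- exact: vnormsq_ge0.
- exact: vnormsq_ge0.
by rewrite !kraus_vnormsq // -zE !setf_id.
Qed.

End ProductStates.

(** * EPR pairs *)

Section EPRLeaf.
Variables (R : realType) (N D : nat).
Local Notation C := R[i].
Local Notation vec := ('I_D -> C).
Local Notation state := (gstate R N D).
Implicit Types (u v w : vec) (f g a : 'I_N -> vec) (i j k : 'I_N).

Lemma prod_setf2 (S : comNzRingType) (T : Type) (G : 'I_N -> T -> S) (a : 'I_N -> T) i j x y :
  i != j -> \prod_l G l (setf (setf a j y) i x l) =
            G i x * G j y * \prod_(l | (l != i) && (l != j)) G l (a l).
Proof.
move=> ij; rewrite (bigD1 i) //= (bigD1 j) 1?eq_sym //= mulrA /setf !eqxx.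
rewrite [j == i]eq_sym (negPf ij); congr (_ * _).
by apply: eq_bigr => l /andP[/negPf -> /negPf ->].
Qed.

Lemma dotp_lin (s t : C) u v w :
  dotp (fun d => s * u d + t * v d) w = s * dotp u w + t * dotp v w.
Proof.
by rewrite /dotp !mulr_sumr -big_split; apply: eq_bigr => d _ /=; rewrite mulrDl !mulrA.
Qed.

Lemma dotp_linr (s t : C) u v w :
  dotp w (fun d => s * u d + t * v d) = (s^*)%R * dotp w u + (t^*)%R * dotp w v.
Proof. by rewrite dotpC dotp_lin rmorphD !rmorphM /= -!dotpC. Qed.

Lemma orthonormal2_dotp u1 u2 : orthonormal2 u1 u2 ->
  [/\ dotp u1 u1 = 1, dotp u2 u2 = 1, dotp u1 u2 = 0 & dotp u2 u1 = 0].
Proof.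
move=> [h1 [h2 h3]]; split=> //; rewrite dotpC /dotp h3; exact: rmorph0.
Qed.

Lemma vnormsq_orthonormal2 (s t : C) u1 u2 : orthonormal2 u1 u2 ->
  vnormsq (fun d => s * u1 d + t * u2 d) = normsq s + normsq t.
Proof.
move=> /orthonormal2_dotp[h11 h22 h12 h21]; apply: (@complexI R).
rewrite -dotpE dotp_lin !dotp_linr h11 h22 h12 h21 rmorphD /= -!mul_conjc; ring.
Qed.

Lemma actv_outer v w : actv (\matrix_(d, e) (w d * ((w e)^*)%R)) v = fun d => dotp v w * w d.
Proof.
apply: functional_extensionality => d; rewrite /actv /dotp mulr_suml.
by apply: eq_bigr => e _; rewrite mxE -mulrA mulrC [(_^* * _)%R]mulrC.
Qed.

Lemma norm2_EPR_between (psi : state) i j u1 u2 v1 v2 a :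
  i != j -> orthonormal2 u1 u2 -> orthonormal2 v1 v2 ->
  (forall b, psi b = (u1 (b i) * v1 (b j) + u2 (b i) * v2 (b j)) *
      \prod_(l | (l != i) && (l != j)) a l (b l)) ->
  norm2 psi = (2 * \prod_(l | (l != i) && (l != j)) vnormsq (a l))%:C.
Proof.
move=> ij /orthonormal2_dotp[u11 u22 u12 u21] /orthonormal2_dotp[v11 v22 v12 v21] psiE.
pose p u v := setf (setf a j v) i u.
have psiE' b : psi b = prodst (p u1 v1) b + prodst (p u2 v2) b.
  by rewrite psiE /prodst !(prod_setf2 (fun l (x : vec) => x (b l))) // mulrDl.
have -> : norm2 psi = inner (prodst (p u1 v1)) (prodst (p u1 v1)) +
    inner (prodst (p u1 v1)) (prodst (p u2 v2)) +
    (inner (prodst (p u2 v2)) (prodst (p u1 v1)) +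
    inner (prodst (p u2 v2)) (prodst (p u2 v2))).
  rewrite /norm2 /inner -!big_split; apply: eq_bigr => b _ /=.
  by rewrite psiE' rmorphD /=; ring.
have inE u v u' v' : inner (prodst (p u v)) (prodst (p u' v')) = dotp u u' * dotp v v' *
    (\prod_(l | (l != i) && (l != j)) vnormsq (a l))%:C.
  rewrite inner_prodst rmorph_prod -[in RHS](eq_bigr _ (fun l _ => dotpE (a l))).
  rewrite /p (bigD1 i) //= (bigD1 j) 1?eq_sym //= mulrA /setf !eqxx [j == i]eq_sym (negPf ij).
  by congr (_ * _); apply: eq_bigr => l /andP[/negPf -> /negPf ->].
rewrite !inE u11 u22 u12 u21 v11 v22 v12 v21 rmorphM /= rmorph_nat; ring.
Qed.

(** Every term still containing the zero vector at [i] vanishes, which leaves a single product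
    state. *)
Lemma norm2_wrep_setf0 c0 f g i w :
  norm2 (wrep c0 (setf f i (fun=> 0)) (setf g i w)) = (wcoord f (setf g i w) i)%:C.
Proof.
have z0 h : h i = (fun=> 0) -> prodst h = (fun=> 0) :> state.
  by move=> hi; apply: functional_extensionality => b; rewrite /prodst (bigD1 i) //= hi mul0r.
have -> : wrep c0 (setf f i (fun=> 0)) (setf g i w) = prodst (setf f i w).
  apply: functional_extensionality => b; rewrite /wrep z0 ?mulr0 ?add0r; last by rewrite /setf eqxx.
  rewrite (bigD1 i) //= big1 ?addr0 => [|k ki].
    by rewrite setf_same {2}/setf eqxx.
  by rewrite z0 // /setf eq_sym (negPf ki) eqxx.
rewrite norm2_prodst (bigD1 i) //= /wcoord /setf eqxx; congr (_ * _)%:C.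
by apply: eq_bigr => l /negPf ->.
Qed.

Lemma EPR_between_wcoord c0 f g i j : EPR_between (wrep c0 f g) i j ->
  exists2 n : R, norm2 (wrep c0 f g) = (2 * n)%:C & n <= wcoord f g i.
Proof.
move=> [ij [u1 [u2 [v1 [v2 [a [hu [hv hpsi]]]]]]]].
exists (\prod_(l | (l != i) && (l != j)) vnormsq (a l)).
  exact: norm2_EPR_between hpsi.
set A := \prod_(_ | _) _.
(* Contract party i with a vector w of span (u1, u2) orthogonal to f i: only the g i
   term of the superposition survives, and the EPR state becomes a product state. *)
have [s [t [st0 wf]]] : exists s t : C, 0 < normsq s + normsq t /\
    dotp (f i) (fun d => s * u1 d + t * u2 d) = 0.
  pose p := dotp (f i) u1; pose q := dotp (f i) u2.
  have [p0|p0] := eqVneq p 0.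
    exists 1, 0; rewrite dotp_linr -/p p0 mulr0 rmorph0 mul0r addr0; split=> //.
    by rewrite /normsq /=; lra.
  exists ((q^*)%R), (- (p^*)%R); rewrite dotp_linr rmorphN /= !conjCK -/p -/q; split; last by ring.
  rewrite ltr_wpDl ?normsq_ge0 // lt_neqAle eq_sym normsq_ge0 andbT normsq_eq0.
  by rewrite oppr_eq0 conjC_eq0.
pose w : vec := fun d => s * u1 d + t * u2 d; rewrite -/w in wf.
(* The unnormalized rank-one operator |w><w|; only linearity is used, not membership in an
   instrument. *)
pose M : 'M[C]_D := \matrix_(d, e) (w d * ((w e)^*)%R).
(* The vector in which the contraction leaves party [j]. It is as long as [w] because the pair is
   maximally entangled. *)
pose v : vec := fun d => (s^*)%R * v1 d + (t^*)%R * v2 d.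
have nw : vnormsq w = normsq s + normsq t by exact: vnormsq_orthonormal2.
have normsqC z : normsq ((z^*)%R) = normsq z by case: z => x y; rewrite /normsq /= sqrrN.
have nv : vnormsq v = normsq s + normsq t by rewrite /v vnormsq_orthonormal2 // !normsqC.
have left_norm : norm2 (apply_local i M (wrep c0 f g)) =
    (wcoord f (setf g i (fun d => dotp (g i) w * w d)) i)%:C.
  rewrite apply_local_wrep !actv_outer wf -(norm2_wrep_setf0 c0).
  by congr (norm2 (wrep _ (setf _ _ _) _)); apply: functional_extensionality => d; rewrite mul0r.
have [hu11 hu22 hu12 hu21] := orthonormal2_dotp hu.
have right_state : apply_local i M (wrep c0 f g) = prodst (setf (setf a j v) i w).
  have -> : wrep c0 f g = fun b => prodst (setf (setf a j v1) i u1) b +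
                                   prodst (setf (setf a j v2) i u2) b.
    apply: functional_extensionality => b; rewrite hpsi /prodst.
    by rewrite !(prod_setf2 (fun l (x : vec) => x (b l))) // mulrDl.
  rewrite apply_localD !apply_local_prodst !setf_same !setf_at !actv_outer.
  rewrite {1 4}/w !dotp_linr hu11 hu12 hu21 hu22.
  apply: functional_extensionality => b; rewrite /prodst.
  rewrite !(prod_setf2 (fun l (x : vec) => x (b l))) //.
  by rewrite /v /w; ring.
(* The norm of the contracted state computed in both ways; Cauchy-Schwarz for [g i] and [w] then
   gives the bound. *)
have : (normsq (dotp (g i) w) * vnormsq w) * \prod_(l | l != i) vnormsq (f l) =
    vnormsq w * vnormsq v * A.
  apply: (@complexI R); rewrite /A -(prod_setf2 (fun _ => @vnormsq R D)) // -norm2_prodst.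
  by rewrite -right_state left_norm /wcoord {1}/setf eqxx vnormsqZ.
rewrite nw nv; set B := \prod_(_ | _) _ => AB.
have B0 : 0 <= B by apply: prodr_ge0 => l _; exact: vnormsq_ge0.
have := ler_wpM2r B0 (cauchy_schwarz (g i) w); rewrite nw.
rewrite /wcoord -/B => cs; rewrite -(ler_pM2l st0) -(ler_pM2l st0).
apply: (@le_trans _ _ ((normsq s + normsq t) * (normsq (dotp (g i) w) * B))).
  by rewrite le_eqVlt mulrA -AB; apply/orP; left; apply/eqP; ring.
apply: ler_wpM2l; first exact: ltW.
by apply: le_trans cs _; rewrite le_eqVlt; apply/orP; left; apply/eqP; ring.
Qed.

Lemma EPR_between_sym (psi : state) i j : EPR_between psi i j -> EPR_between psi j i.
Proof.
move=> [ij [u1 [u2 [v1 [v2 [a [hu [hv h]]]]]]]]; split; first by rewrite eq_sym.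
exists v1, v2, u1, u2, a; split=> //; split=> // b; rewrite h ![_ (b i) * _]mulrC.
by congr (_ * _); apply: eq_bigl => l; rewrite andbC.
Qed.

(** Half of the squared norm is below the coordinates of both ends, hence below their minimum. *)
Lemma EPR_between_mono c0 f g i j : EPR_between (wrep c0 f g) i j ->
  norm2 (wrep c0 f g) <= (2 * mono i (wcoord f g))%:C.
Proof.
move=> h; have [ij _] := h; have [n e ni] := EPR_between_wcoord h.
have [n' e' nj] := EPR_between_wcoord (EPR_between_sym h).
have nn' : n = n' by move: e'; rewrite e => /complexI; lra.
rewrite e lecR ler_pM2l //; apply: le_trans (min_le_mono (wcoord_ge0 f g) _); last first.
  by rewrite eq_sym; exact: ij.
by rewrite le_min ni nn'.
Qed.

End EPRLeaf.

(** * W-class vectors and the upper bounds *)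

Section WVectors.
Variables (R : realType) (N : nat).
Local Notation C := R[i].
Implicit Types (x : 'I_N -> R) (k l : 'I_N).

(** The amplitude [c0] is free and nothing is normalized, so that inner nodes of a protocol are
    covered. *)
Definition Wvec (D : nat) (c0 : C) x : gstate R N D.+2 := fun b =>
  (if b == [ffun _ => ord0] then c0 else 0) +
  \sum_k (if b == [ffun l => if l == k then inord 1 else ord0]
          then (Num.sqrt (x k))%:C else 0).

Arguments Wvec : clear implicits.

Definition basisv (D : nat) (d : 'I_D) : 'I_D -> C := fun e => (e == d)%:R.

Lemma vnormsq_basisv D (d : 'I_D) : vnormsq (basisv d) = 1.
Proof.
rewrite /vnormsq (bigD1 d) //= big1 => [|e ed]; last first.
  by apply/eqP; rewrite normsq_eq0 /basisv (negPf ed).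
by rewrite /basisv eqxx /normsq /=; ring.
Qed.

Lemma prodst_basisv D (t : 'I_N -> 'I_D) (b : idx N D) :
  prodst (fun l => basisv (t l)) b = (b == finfun t)%:R.
Proof.
rewrite /prodst /basisv; have [->|bt] := eqVneq b (finfun t).
  by rewrite big1 // => l _; rewrite ffunE eqxx.
have [l bl] : exists l, b l != t l.
  apply/existsP; rewrite -negb_forall; apply: contra bt => /forallP h.
  by apply/eqP/ffunP => l; rewrite ffunE; apply/eqP.
by rewrite (bigD1 l) //= (negPf bl) mul0r.
Qed.

Lemma Wvec_wrep D c0 x : Wvec D c0 x =
  wrep c0 (fun _ => basisv ord0) (fun k d => (Num.sqrt (x k))%:C * basisv (inord 1) d).
Proof.
apply: functional_extensionality => b; rewrite /Wvec /wrep; congr (_ + _).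
  rewrite (prodst_basisv (fun _ => ord0)).
  have -> : finfun (fun _ : 'I_N => ord0 : 'I_D.+2) = [ffun _ => ord0] by [].
  by case: eqP; rewrite ?mulr1 ?mulr0.
apply: eq_bigr => k _.
have -> : prodst (setf (fun _ => basisv ord0) k
    (fun d => (Num.sqrt (x k))%:C * basisv (inord 1) d)) b =
    (Num.sqrt (x k))%:C * prodst (fun l => basisv ((if l == k then inord 1 else ord0) : 'I_D.+2)) b.
  rewrite /prodst (bigD1 k) //= [in RHS](bigD1 k) //= /setf eqxx mulrA; congr (_ * _).
  by apply: eq_bigr => l /negPf ->.
by rewrite prodst_basisv; case: eqP; rewrite ?mulr1 ?mulr0.
Qed.

Lemma wcoord_Wvec D x : (forall k, 0 <= x k) ->
  wcoord (fun _ => basisv (ord0 : 'I_D.+2))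
    (fun k d => (Num.sqrt (x k))%:C * basisv (inord 1) d) = x.
Proof.
move=> x0; apply: functional_extensionality => k.
rewrite /wcoord big1 => [|l _]; last exact: vnormsq_basisv.
by rewrite vnormsqZ vnormsq_basisv !mulr1 /normsq /= expr0n addr0 sqr_sqrtr.
Qed.

Lemma succ_prob_EPR_with_le D c0 x k (T : protocol R N D.+2) : (forall l, 0 <= x l) ->
  valid T -> succ_prob (EPR_with k) T (Wvec D c0 x) <= (2 * mono k x)%:C.
Proof.
move=> x0 vT; rewrite Wvec_wrep -[in leRHS](wcoord_Wvec D x0).
rewrite -(big_pred1_eq +%R k (fun k => mono k _)).
apply: succ_prob_le_mono => // d f g [j h]; rewrite big_pred1_eq; exact: EPR_between_mono h.
Qed.

Lemma succ_prob_EPR_some_le D c0 x (T : protocol R N D.+2) : (forall l, 0 <= x l) ->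
  valid T -> succ_prob (@EPR_some R N D.+2) T (Wvec D c0 x) <= (\sum_k mono k x)%:C.
Proof.
move=> x0 vT; rewrite Wvec_wrep -[in leRHS](wcoord_Wvec D x0) -[X in X%:C]mul1r.
apply: succ_prob_le_mono => // d f g [i [j h]]; rewrite mul1r.
have [n e _] := EPR_between_wcoord h; have [ij _] := h.
(* Each end of the pair contributes at least half of the squared norm to the sum. *)
have := EPR_between_mono h; have := EPR_between_mono (EPR_between_sym h).
rewrite e !lecR (bigD1 i) //= (bigD1 j) 1?eq_sym //=.
have : 0 <= \sum_(k | (k != i) && (k != j)) mono k (wcoord f g).
  by apply: sumr_ge0 => k _; apply: mono_ge0; exact: wcoord_ge0.
lra.
Qed.

(** * The sorted formulas for eta and kappa in terms of a maximal coordinate *)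

Lemma xsorted_argmax x k : (forall l, x l <= x k) -> nth 0 (xsorted x) 0 = x k.
Proof.
move=> xk; have srt : sorted (fun a b : R => b <= a) (xsorted x).
  by apply: sort_sorted => a b; exact: le_total.
have mem : x k \in xsorted x by rewrite mem_sort map_f // mem_enum.
have sub y : y \in xsorted x -> y <= x k.
  by rewrite mem_sort => /mapP[l _ ->].
case: (xsorted x) srt mem sub => [|y s] //= srt mem sub.
apply/le_anti; rewrite sub ?mem_head //=.
move: mem; rewrite inE => /orP[/eqP-> //|ks].
have tr : transitive (fun a b : R => b <= a) by move=> a b c h1 h2; exact: le_trans h2 h1.
by have /allP/(_ _ ks) := order_path_min tr srt.
Qed.

Lemma big_xsorted (idx0 : R) (op : Monoid.com_law idx0) (F : R -> R) x k :
  (forall l, x l <= x k) ->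
  \big[op/idx0]_(1 <= i < N) F (nth 0 (xsorted x) i) = \big[op/idx0]_(l | l != k) F (x l).
Proof.
move=> xk; have hd := xsorted_argmax xk.
have sz : size (xsorted x) = N by rewrite size_sort size_map size_enum_ord.
have pm : perm_eq (xsorted x) (x k :: [seq x l | l <- enum 'I_N & l != k]).
  rewrite /xsorted perm_sort -/(map x (k :: _)); apply: perm_map.
  by rewrite -(rem_filter k (enum_uniq 'I_N)); apply: perm_to_rem; rewrite mem_enum.
case: (xsorted x) sz pm hd => [|y s] /= sz pm hd.
  by have := perm_size pm.
move: pm; rewrite hd perm_cons => pm; rewrite big_add1 -{1}sz /=.
rewrite -(big_nth 0 predT F) (perm_big _ pm) /= big_map big_filter.
by rewrite big_enum_cond.
Qed.

(** Each of the N - 1 factors x_k - x_l gives off one x_k; N - 2 of them cancel against the inverse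
    power. *)
Lemma etaW_argmax x k : (3 <= N)%N -> (forall l, 0 <= x l <= x k) -> etaW x = mono k x.
Proof.
move=> N3 xk; have xle l : x l <= x k by have /andP[] := xk l.
rewrite mono_argmax // /etaW (xsorted_argmax xle) (big_xsorted _ (fun y => x k - y) xle) /=.
congr (_ - _); have [->|xk0] := eqVneq (x k) 0.
  (* The inverse of 0 is 0, and its power vanishes because N - 2 is positive. *)
  by rewrite invr0 expr0n subn_eq0 leqNgt N3 !mul0r.
rewrite [in LHS](eq_bigr (fun l => x k * (1 - x l / x k))) => [|l _]; last first.
  by rewrite mulrBr mulr1 mulrCA divff // mulr1.
rewrite big_split /= prodr_const cardC1 card_ord mulrA; congr (_ * _).
have -> : N.-1 = (N - 2).+1 by case: N N3 => [|[|n]] // _; rewrite !subSS subn0.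
by rewrite exprS mulrCA -exprMn mulVf // expr1n mulr1.
Qed.

Lemma kappaW_argmax x k : (3 <= N)%N -> (forall l, 0 <= x l <= x k) ->
  kappaW x = \sum_(l | l != k) x l + mono k x.
Proof.
move=> N3 xk; rewrite /kappaW (etaW_argmax N3 xk) (big_xsorted _ id (k := k)) // => l.
by have /andP[] := xk l.
Qed.

Lemma exists_argmax x : (0 < N)%N -> exists k, forall l, x l <= x k.
Proof.
move=> N0; have [k _ h] := Order.TotalTheory.arg_maxP x (erefl (predT (Ordinal N0))).
by exists k => l; exact: h.
Qed.

End WVectors.

Arguments Wvec {R N} D c0 x _.

(** * Protocols on W-class vectors *)

Section Achievability.
Variables (R : realType) (N : nat).
Local Notation C := R[i].
Local Notation state := (gstate R N 2).
Implicit Types (x p : 'I_N -> R) (k l m : 'I_N) (S : state -> Prop).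
Implicit Types (A B : {set 'I_N}) (L : seq 'I_N).

(** A lower bound on the success probability rather than its value, so that unwanted branches can be
    counted as 0. *)
Definition ach S x (v : R) : Prop :=
  exists T : protocol R N 2, valid T /\ v%:C <= succ_prob S T (Wvec 0 0 x).

Lemma ach_nonpos S x v : v <= 0 -> ach S x v.
Proof.
move=> v0; exists Leaf; split=> //=; apply: (@le_trans _ _ 0); first by rewrite lecR.
by case: (excluded_middle_informative _) => h //=; exact: norm2_ge0.
Qed.

Lemma ach_leaf S x v : S (Wvec 0 0 x) -> v%:C <= norm2 (Wvec 0 0 x) -> ach S x v.
Proof. by move=> Sx vx; exists Leaf; split=> //=; case: (excluded_middle_informative _). Qed.

(** Square roots are taken so that [a] and [c] are the factors acting on the coordinates. *)
Definition diag2 (a c : R) : 'M[C]_2 :=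
  \matrix_(i, j) (if i == j then (Num.sqrt (if i == ord0 then a else c))%:C else 0).

Lemma diag2_gram a c : 0 <= a -> 0 <= c ->
  adjmx (diag2 a c) *m diag2 a c =
  \matrix_(i, j) (if i == j then (if i == ord0 then a else c)%:C else 0).
Proof.
move=> a0 c0; apply/matrixP => i j; rewrite !mxE (bigD1 i) //= big1 ?addr0 => [|e ei]; last first.
  by rewrite !mxE (negPf ei) conjc0 mul0r.
rewrite !mxE eqxx; case: (i == j); last by rewrite mulr0.
rewrite conjc_real -rmorphM /= -expr2 sqr_sqrtr //.
by case: ifP.
Qed.

Lemma apply_local_diag2 k a c x : 0 <= a -> 0 <= c ->
  apply_local k (diag2 a c) (Wvec 0 0 x) = Wvec 0 0 (scl k a c x).
Proof.
move=> a0 c0; apply: functional_extensionality => b; rewrite /apply_local (bigD1 (b k)) //=.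
rewrite big1 ?addr0 => [|j jb]; last by rewrite mxE eq_sym (negPf jb) mul0r.
have -> : [ffun l => if l == k then b k else b l] = b.
  by apply/ffunP => l; rewrite ffunE; case: eqP => // ->.
rewrite mxE eqxx /Wvec !if_same !add0r mulr_sumr; apply: eq_bigr => m _.
case: (b =P _) => [->|_]; last by rewrite mulr0.
rewrite ffunE /scl [m == k]eq_sym -rmorphM /=.
have i10 : (inord 1 == ord0 :> 'I_2) = false by rewrite -val_eqE /= inordK.
by case: (k == m); rewrite ?i10 ?eqxx -sqrtrM.
Qed.

Lemma ach_step S k a c x v w : 0 <= a <= 1 -> 0 <= c <= 1 ->
  ach S (scl k a c x) v -> ach S (scl k (1 - a) (1 - c) x) w -> ach S x (v + w).
Proof.
move=> /andP[a0 a1] /andP[c0 c1] [T [vT hT]] [U [vU hU]].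
exists (Node k (fun j : 'I_2 => if j == ord0 then diag2 a c else diag2 (1 - a) (1 - c))
  (fun j => if j == ord0 then T else U)); split=> /=.
  split=> [|j]; last by case: ifP.
  rewrite big_ord_recl big_ord1 /= !diag2_gram ?subr_ge0 //; apply/matrixP => i j; rewrite !mxE.
  case: eqP => _; last by rewrite addr0.
  by rewrite -rmorphD; case: ifP => _; rewrite addrC subrK.
rewrite big_ord_recl big_ord1 /= !apply_local_diag2 ?subr_ge0 //.
by rewrite rmorphD lerD.
Qed.

(** Each party of [L] measures in the computational basis; outcome 0 erases its own coordinate, and
    outcome 1 is counted as failure. *)
Lemma ach_discard S x v L :
  ach S (fun m => if m \in L then 0 else x m) v -> ach S x v.
Proof.
elim: L x => [|l L IH] x h.
  by move: h; congr (ach _ _ _); apply: functional_extensionality.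
rewrite -[v]addr0; apply: (@ach_step _ l 1 0); rewrite ?lexx ?ler01 //; last exact: ach_nonpos.
apply: IH; move: h; congr (ach _ _ _); apply: functional_extensionality => m.
by rewrite inE /scl; case: eqP => _ /=; case: ifP => _; rewrite ?mul0r ?mul1r.
Qed.

Definition unif A (w : R) : 'I_N -> R := fun m => if m \in A then w else 0.

(** The pair must be orthonormal, so the scalar sqrt(w) is carried by a third party [m], which
    exists since [3 <= N]. *)
Lemma Wvec_pair_EPR k l w : (3 <= N)%N -> k != l -> 0 <= w ->
  EPR_between (Wvec 0 0 (unif [set k; l] w)) k l /\
  norm2 (Wvec 0 0 (unif [set k; l] w)) = (2 * w)%:C.
Proof.
move=> N3 kl w0.
have [m mkl] : exists m, (m != k) && (m != l).
  apply/existsP; apply: contraT; rewrite negb_exists => /forallP h.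
  have : (#|'I_N| <= #|[set k; l]|)%N.
    apply: subset_leq_card; apply/subsetP => m _; rewrite !inE.
    by have := h m; rewrite negb_and !negbK.
  by rewrite card_ord cards2 kl leqNgt N3.
pose e0 : 'I_2 -> C := basisv R ord0; pose e1 : 'I_2 -> C := basisv R (inord 1).
pose a := setf (fun=> e0) m (fun d => (Num.sqrt w)%:C * e0 d).
have e10 : dotp e1 e0 = 0.
  rewrite /dotp big_ord_recl big_ord1 /e1 /e0 /basisv -!val_eqE /= inordK //=.
  by rewrite mul0r rmorph0 mulr0 addr0.
have e01 : dotp e0 e1 = 0 by rewrite dotpC e10 rmorph0.
have e11 : dotp e1 e1 = 1 by rewrite dotpE vnormsq_basisv.
have e00 : dotp e0 e0 = 1 by rewrite dotpE vnormsq_basisv.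
have bE (b : idx N 2) : Wvec 0 0 (unif [set k; l] w) b =
      (e1 (b k) * e0 (b l) + e0 (b k) * e1 (b l)) *
      \prod_(j | (j != k) && (j != l)) a j (b j).
  have -> : \prod_(j | (j != k) && (j != l)) a j (b j) =
      (Num.sqrt w)%:C * \prod_(j | (j != k) && (j != l)) e0 (b j).
    rewrite (bigD1 m) //= [in RHS](bigD1 m) //= mulrA /a setf_at; congr (_ * _).
    by apply: eq_bigr => j /andP[_ /negPf jm]; rewrite /setf jm.
  rewrite Wvec_wrep /wrep mul0r add0r (bigD1 k) //= (bigD1 l) 1?eq_sym //= big1 ?addr0; last first.
    move=> j /andP[jk jl]; rewrite /prodst (bigD1 j) //= setf_at /unif !inE (negPf jk) (negPf jl).
    by rewrite sqrtr0 !mul0r.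
  rewrite /unif !inE !eqxx orbT /=.
  have PE (i j : 'I_N) (u : 'I_2 -> C) : i != j -> prodst (setf (fun=> e0) i u) b =
     u (b i) * e0 (b j) * \prod_(n | (n != i) && (n != j)) e0 (b n).
    move=> ij; have := prod_setf2 (fun n (y : 'I_2 -> C) => y (b n)) (fun=> e0) u e0 ij.
    by rewrite (setf_id (fun=> e0) j).
  rewrite -/e0 -/e1 (PE k l) // (PE l k) 1?eq_sym //.
  rewrite (eq_bigl (fun n => (n != k) && (n != l)) _ (fun n => andbC _ _)); ring.
have h10 : orthonormal2 e1 e0 by [].
have h01 : orthonormal2 e0 e1 by [].
split; first by split=> //; exists e1, e0, e0, e1, a.
rewrite (norm2_EPR_between kl h10 h01 bE) (bigD1 m) //= big1 => [|j /andP[_ jm]].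
  by rewrite /a setf_at vnormsqZ vnormsq_basisv !mulr1 /normsq /= expr0n addr0 sqr_sqrtr.
by rewrite /a /setf (negPf jm) vnormsq_basisv.
Qed.

(** Party [l] lowers its coordinate to [x k] without affecting the others, which then disentangle
    themselves. *)
Lemma ach_EPR_with k l x : (3 <= N)%N -> k != l -> (forall m, 0 <= x m) -> x k <= x l ->
  ach (EPR_with k) x (2 * x k).
Proof.
move=> N3 kl x0 xkl; have [xl0|xl0] := eqVneq (x l) 0.
  by apply: ach_nonpos; have := x0 k; lra.
have xl : 0 < x l by rewrite lt_neqAle eq_sym xl0 x0.
rewrite -[2 * _]addr0; apply: (@ach_step _ l 1 (x k / x l)).
- by rewrite lexx ler01.
- by rewrite divr_ge0 //= ler_pdivrMr // mul1r.
- apply: (@ach_discard _ _ _ (enum (~: [set k; l]))).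
  have -> : (fun m => if m \in enum (~: [set k; l]) then 0 else scl l 1 (x k / x l) x m) =
      unif [set k; l] (x k).
    apply: functional_extensionality => m; rewrite mem_enum /unif !inE /scl.
    have [->|mk] /= := eqVneq m k; first by rewrite (negPf kl) mul1r.
    by case: eqVneq => // ->; rewrite divfK.
  have [h n] := Wvec_pair_EPR N3 kl (x0 k).
  by apply: ach_leaf; [exists l|rewrite n].
- exact: ach_nonpos.
Qed.

(** The parties of [A] are tied at [c], those of [L] still wait at ratio [p] to [c], and the others
    have been dropped. *)
Definition partial A L p (c : R) : 'I_N -> R :=
  fun m => if m \in A then c else if m \in L then c * p m else 0.

Lemma scl_partial_tie A L p c l : l \notin A ->
  scl l (p l) 1 (partial A (l :: L) p c) = partial (l |: A) L p (c * p l).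
Proof.
move=> lA; apply: functional_extensionality => m; rewrite /scl /partial !inE.
case: eqVneq => [->|ml] /=; first by rewrite (negPf lA) mul1r.
by case: ifP => _; [|case: ifP => _]; ring.
Qed.

Lemma scl_partial_drop A L p c l : l \notin A -> l \notin L ->
  scl l (1 - p l) (1 - 1) (partial A (l :: L) p c) = partial A L p (c * (1 - p l)).
Proof.
move=> lA lL; apply: functional_extensionality => m; rewrite /scl /partial !inE.
case: eqVneq => [->|ml] /=; first by rewrite (negPf lA) (negPf lL) subrr mul0r.
by case: ifP => _; [|case: ifP => _]; ring.
Qed.

(** The first tie yields a pair at once, worth 2 c p_l; after a drop the next party of [L] tries at
    the common value c (1 - p_l). *)
Lemma ach_EPR_with_partial k L p c : (3 <= N)%N -> (forall l, 0 <= p l <= 1) -> 0 <= c ->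
  uniq L -> k \notin L ->
  ach (EPR_with k) (partial [set k] L p c) (2 * (c - c * \prod_(l <- L) (1 - p l))).
Proof.
move=> N3 p01; elim: L c => [|l L IH] c c0.
  by move=> _ _; apply: ach_nonpos; rewrite big_nil; lra.
rewrite inE negb_or => /andP[lL uL] /andP[kl kL]; rewrite big_cons.
have /andP[p0 p1] := p01 l.
set q := \prod_(_ <- _) _ in IH *.
have -> : 2 * (c - c * ((1 - p l) * q)) =
    2 * (c * p l) + 2 * (c * (1 - p l) - c * (1 - p l) * q) by ring.
have lk : l \notin [set k] by rewrite inE eq_sym.
apply: (@ach_step _ l (p l) 1) => //; first by rewrite ler01 lexx.
  rewrite scl_partial_tie //.
  have y0 m : 0 <= partial (l |: [set k]) L p (c * p l) m.
    rewrite /partial; case: ifP => _; first exact: mulr_ge0.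
    by case: ifP => _ //; rewrite !mulr_ge0 //; have /andP[] := p01 m.
  have := @ach_EPR_with k l _ N3 kl y0; rewrite /partial !inE !eqxx orbT /=; exact.
by rewrite scl_partial_drop //; apply: IH; rewrite ?mulr_ge0 ?subr_ge0.
Qed.

End Achievability.

(** * Random distillation *)

Section RandomDistillation.
Variables (R : realType) (N : nat).
Implicit Types (x p : 'I_N -> R) (k l m : 'I_N) (A B : {set 'I_N}) (L : seq 'I_N).

(* The supremum of the probability of EPR_some over protocols on x is at least r. *)
Definition sup_ge x (r : R) : Prop := forall v, v < r -> ach (@EPR_some R N 2) x v.

Lemma sup_ge_nonpos x r : r <= 0 -> sup_ge x r.
Proof. by move=> r0 v vr; apply: ach_nonpos; exact: ltW (lt_le_trans vr r0). Qed.

Lemma sup_ge_le x r s : r <= s -> sup_ge x s -> sup_ge x r.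
Proof. by move=> rs h v vr; apply: h; exact: lt_le_trans vr rs. Qed.

Lemma sup_ge_step k a c x r s : 0 <= a <= 1 -> 0 <= c <= 1 ->
  sup_ge (scl k a c x) r -> sup_ge (scl k (1 - a) (1 - c) x) s -> sup_ge x (r + s).
Proof.
move=> a01 c01 hr hs v vrs; pose d := (r + s - v) / 2.
have -> : v = (r - d) + (s - d) by rewrite /d; field.
by apply: (ach_step a01 c01); [apply: hr|apply: hs]; rewrite /d; lra.
Qed.

(** Bounds the set of achievable rates, so that its supremum can be taken. *)
Lemma sup_ge_le_mono x r : (forall l, 0 <= x l) -> sup_ge x r -> r <= \sum_k mono k x.
Proof.
move=> x0 h; rewrite leNgt; apply/negP => lt.
have [|T [vT hT]] := h ((r + \sum_k mono k x) / 2); first lra.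
have := le_trans hT (succ_prob_EPR_some_le 0 x0 vT); rewrite lecR; lra.
Qed.

Lemma partial_nil A p w : partial A [::] p w = unif A w.
Proof. by apply: functional_extensionality => m; rewrite /partial /unif in_nil. Qed.

(* The parties of L are tied with the maximum or discarded one after the other; D is the
   relative loss on the symmetric state of A, which needs all parties of A to be tied. *)
Lemma sup_ge_partial A k (D : R) p : (forall l, 0 <= p l <= 1) ->
  (forall B (w : R), k \in B -> B \subset A -> 0 <= w ->
     sup_ge (unif B w) (w * (#|B|%:R - (B == [set k])%:R - (B == A)%:R * D))) ->
  forall L B (c : R), uniq L -> (forall l, l \in L -> l \notin B) -> k \in B ->
    B :|: [set l in L] \subset A -> 0 <= c ->
    sup_ge (partial B L p c)
      (c * (#|B|%:R + \sum_(l <- L) p l - (B == [set k])%:R * \prod_(l <- L) (1 - p l) -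
            (B :|: [set l in L] == A)%:R * D * \prod_(l <- L) p l)).
Proof.
move=> p01 symm; elim=> [|l L IH] B c.
  move=> _ _ kB BA c0; rewrite partial_nil !big_nil addr0 !mulr1.
  have e : B :|: [set l in [::]] = B by apply/setP => m; rewrite !inE orbF.
  by rewrite e in BA *; exact: symm.
move=> /andP[lL uL] LB kB BA c0.
have lB : l \notin B by apply: LB; exact: mem_head.
have /andP[p0 p1] := p01 l; have lA : l \in A.
  by apply: (subsetP BA); rewrite !inE eqxx orbT.
have UE : (l |: B) :|: [set m in L] = B :|: [set m in l :: L].
  by apply/setP => m; rewrite !inE orbCA orbA.
have lk : l != k by apply: contraNneq lB => ->.
(* A tie excludes ending with [k] alone and a drop excludes ending with all of [A], so each branch
   keeps only one of the two corrections. *)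
have tieF : (l |: B == [set k]) = false.
  by apply/negP => /eqP/setP/(_ l); rewrite !inE eqxx (negPf lk).
have dropF : (B :|: [set m in L] == A) = false.
  by apply/negP => /eqP/setP/(_ l); rewrite lA !inE (negPf lB) (negPf lL).
have BL m : m \in L -> m \notin B by move=> mL; apply: LB; rewrite inE mL orbT.
have BL' m : m \in L -> m \notin l |: B.
  by move=> mL; rewrite !inE negb_or BL // andbT; apply: contraNneq lL => <-.
have kB' : k \in l |: B by rewrite !inE kB orbT.
have UA : (l |: B) :|: [set m in L] \subset A by rewrite UE.
have BLA : B :|: [set m in L] \subset A.
  apply: subset_trans BA; apply: setUS; apply/subsetP => m.
  by rewrite !inE => ->; rewrite orbT.
have h1 := IH _ _ uL BL' kB' UA (mulr_ge0 c0 p0).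
have q0 : 0 <= 1 - p l by rewrite subr_ge0.
have h2 := IH _ _ uL BL kB BLA (mulr_ge0 c0 q0).
rewrite -scl_partial_tie // in h1; rewrite -scl_partial_drop // in h2.
have one01 : 0 <= (1 : R) <= 1 by rewrite ler01 lexx.
apply: sup_ge_le (sup_ge_step (p01 l) one01 h1 h2).
rewrite UE tieF dropF cardsU1 lB !big_cons natrD le_eqVlt -[true%:R]/(1 : R) -[false%:R]/(0 : R).
by apply/orP; left; apply/eqP; ring.
Qed.

(** The first outcome of the weak measurement leaves [k] maximal, with all other parties of [A] at
    ratio 1 - e. *)
Lemma scl_unif_lower k A (e w : R) : k \in A ->
  scl k (1 - e) 1 (unif A w) = partial [set k] (enum (A :\ k)) (fun=> 1 - e) w.
Proof.
move=> kA; apply: functional_extensionality => m.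
rewrite /scl /unif /partial mem_enum !inE; case: eqVneq => [->|mk] /=.
  by rewrite kA mul1r.
by case: ifP => _; rewrite ?mulr0 // mulrC.
Qed.

Lemma scl_unif_drop k A (e w : R) : k \in A ->
  scl k (1 - (1 - e)) (1 - 1) (unif A w) = unif (A :\ k) (w * e).
Proof.
move=> kA; apply: functional_extensionality => m.
rewrite /scl /unif !inE; case: eqVneq => [->|mk] /=; first by rewrite subrr mul0r.
by case: ifP => _; rewrite ?mulr0 //; ring.
Qed.

(* One round of weak measurements with strength e multiplies the loss D by at most 1 - e,
   up to an error of second order in e. *)
Lemma unif_round A (D e : R) : (3 <= #|A|)%N -> 0 <= D -> 0 < e < 1 ->
  (forall B (w : R), (1 < #|B| < #|A|)%N -> 0 <= w -> sup_ge (unif B w) (w * #|B|%:R)) ->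
  (forall w : R, 0 <= w -> sup_ge (unif A w) (w * (#|A|%:R - D))) ->
  forall w : R, 0 <= w -> sup_ge (unif A w) (w * (#|A|%:R - (e ^+ 2 + D * (1 - e)))).
Proof.
move=> A3 D0 /andP[e0 e1] IH AD w w0.
have [k kA] : exists k, k \in A by apply/card_gt0P; exact: ltn_trans A3.
have cA : #|A| = (#|A :\ k|.+1)%N by rewrite (cardsD1 k A) kA.
have A'2 : (2 <= #|A :\ k|)%N by rewrite -ltnS -cA.
have e01 : 0 <= 1 - e <= 1 by apply/andP; split; lra.
have one01 : 0 <= (1 : R) <= 1 by rewrite ler01 lexx.
have kA1 : [set k] != A by apply: contraTneq A3 => <-; rewrite cards1.
have symm B (v : R) : k \in B -> B \subset A -> 0 <= v ->
    sup_ge (unif B v) (v * (#|B|%:R - (B == [set k])%:R - (B == A)%:R * D)).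
  move=> kB BA v0; have [->|Bk] := eqVneq B [set k].
    by rewrite cards1 (negPf kA1) mul0r !subr0 subrr mulr0; exact: sup_ge_nonpos.
  have [->|BA'] := eqVneq B A; first by rewrite mul1r subr0; exact: AD.
  rewrite mul0r !subr0; apply: IH => //; apply/andP; split.
    rewrite ltn_neqAle card_gt0 andbC; apply/andP; split; first by apply/set0Pn; exists k.
    rewrite eq_sym; apply: contra Bk => /cards1P[j ej].
    by move: kB; rewrite ej inE => /eqP ->.
  by apply: proper_card; rewrite properEneq BA' BA.
have UA : [set k] :|: [set l in enum (A :\ k)] = A.
  apply/setP => m; rewrite !inE mem_enum !inE.
  by case: eqVneq => // ->; rewrite kA.
have UAs : [set k] :|: [set l in enum (A :\ k)] \subset A by rewrite UA.
have kl l : l \in enum (A :\ k) -> l \notin [set k].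
  by rewrite mem_enum !inE => /andP[].
have h1 := sup_ge_partial (fun=> e01) symm (enum_uniq _) kl (set11 k) UAs w0.
rewrite -scl_unif_lower // in h1.
have h2 : sup_ge (unif (A :\ k) (w * e)) (w * e * #|A :\ k|%:R).
  apply: (IH (A :\ k) (w * e)); first by rewrite A'2 cA ltnS leqnn.
  by rewrite mulr_ge0 // ltW.
rewrite -scl_unif_drop // in h2.
apply: sup_ge_le (sup_ge_step e01 one01 h1 h2).
rewrite UA !eqxx cards1 !big_enum /= sumr_const !prodr_const subKr !mul1r.
rewrite -[w * e * _]mulrA -mulrDr ler_wpM2l // cA -[_ *+ _]mulr_natr -natr1.
(* With n = |A| - 1, the loss e^n comes from dropping everyone but [k], and D (1 - e)^n from tying
   everyone again. Since n is at least 2, squares bound both powers. *)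
have pw (y : R) : 0 <= y <= 1 -> y ^+ #|A :\ k| <= y ^+ 2.
  by move=> /andP[y0 y1]; exact: ler_wiXn2l.
have he : e ^+ #|A :\ k| <= e ^+ 2 by apply: pw; rewrite !ltW.
have hD : D * (1 - e) ^+ #|A :\ k| <= D * (1 - e).
  apply: ler_wpM2l => //; apply: le_trans (pw _ e01) _.
  by have /andP[q0 q1] := e01; rewrite expr2 ler_piMl.
by lra.
Qed.

(** Induction on the size of [A], starting from an EPR pair. For larger [A], a best rate below |A|
    would be improved by one more round, so no limit of protocols has to be constructed. *)
Lemma sup_ge_unif A (w : R) : (3 <= N)%N -> (1 < #|A|)%N -> 0 <= w ->
  sup_ge (unif A w) (w * #|A|%:R).
Proof.
move=> N3; move: {2}#|A| (leqnn #|A|) => n; elim: n A w => [|n IH] A w.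
  by rewrite leqn0 => /eqP ->.
move=> An A2 w0; have [A3|] := leqP 3 #|A|; last first.
  rewrite ltnS => A3; have A2' : #|A| == 2%N by rewrite eqn_leq A3.
  have /cards2P[i [j [ij ->]]] := A2'.
  have [h nE] := Wvec_pair_EPR N3 ij w0.
  rewrite cards2 ij => v vw; apply: ach_leaf; first by exists i, j.
  by rewrite nE lecR ltW // mulrC.
have IH' B (v : R) : (1 < #|B| < #|A|)%N -> 0 <= v -> sup_ge (unif B v) (v * #|B|%:R).
  by move=> /andP[B1 BA]; apply: IH => //; rewrite -ltnS; exact: leq_trans BA An.
pose E : R -> Prop := fun r => forall v : R, 0 <= v -> sup_ge (unif A v) (v * r).
have E0 : E 0 by move=> v v0; rewrite mulr0; exact: sup_ge_nonpos.
have Eub : classical_sets.has_ubound E.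
  exists (\sum_k mono k (unif A 1)) => r /(_ 1 ler01); rewrite mul1r; apply: sup_ge_le_mono.
  by move=> l; rewrite /unif; case: ifP.
(* The best rate belongs to [E] because [sup_ge] only asks for values strictly below it. *)
have Esup : E (sup E).
  move=> v v0 u uv; have [v00|v00] := eqVneq v 0.
    by apply: ach_nonpos; move: uv; rewrite v00 mul0r => /ltW.
  have vp : 0 < v by rewrite lt_neqAle eq_sym v00.
  have : u / v < sup E by rewrite ltr_pdivrMr // mulrC.
  case/sup_gt; first by exists 0.
  by move=> r Er; rewrite ltr_pdivrMr // mulrC => /(Er v v0).
have nE : #|A|%:R <= sup E.
  rewrite leNgt; apply/negP => lt.
  pose D := #|A|%:R - sup E; have D0 : 0 < D by rewrite /D subr_gt0.
  have ED (v : R) : 0 <= v -> sup_ge (unif A v) (v * (#|A|%:R - D)).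
    by rewrite /D subKr; exact: Esup.
  (* A round lowers the loss by e (D - e), which is positive for this [e]; the other bound keeps [e]
     below 1. *)
  pose e := Num.min (D / 2) (1 / 2).
  have e0 : 0 < e by rewrite /e lt_min !divr_gt0.
  have e1 : e <= 1 / 2 by rewrite /e ge_min lexx orbT.
  have eD : e <= D / 2 by rewrite /e ge_min lexx.
  have e01 : 0 < e < 1 by rewrite e0 /=; lra.
  have /(ub_le_sup Eub) := unif_round A3 (ltW D0) e01 IH' ED.
  suff : e * (D - e) > 0 by rewrite /D expr2; nra.
  by rewrite mulr_gt0 // subr_gt0; lra.
by apply: sup_ge_le (Esup w w0); rewrite ler_wpM2l.
Qed.

End RandomDistillation.

(** * Optimal protocols for the given state and the final comparison of bounds *)

Section Conclusion.
Variables (R : realType) (N : nat) (x : 'I_N -> R).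
Hypotheses (N3 : (3 <= N)%N) (x_ge0 : forall l, 0 <= x l).

Lemma partial_ratio k : 0 < x k ->
  partial [set k] (enum [set~ k]) (fun l => x l / x k) (x k) = x.
Proof.
move=> xk0; apply: functional_extensionality => m; rewrite /partial mem_enum !inE.
by case: eqVneq => [->|mk] //=; rewrite mulrC divfK ?gt_eqF.
Qed.

Lemma big_enum_setC1 (idx0 : R) (op : Monoid.com_law idx0) k (F : 'I_N -> R) :
  \big[op/idx0]_(l <- enum [set~ k]) F l = \big[op/idx0]_(l | l != k) F l.
Proof. by rewrite big_enum /=; apply: eq_bigl => l; rewrite !inE. Qed.

Lemma ach_EPR_with_argmax k : (forall l, x l <= x k) ->
  ach (EPR_with k) x (2 * mono k x).
Proof.
move=> xk; have xk' l : 0 <= x l <= x k by rewrite x_ge0 xk.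
have [xk0|xk0] := eqVneq (x k) 0.
  by apply: ach_nonpos; have := mono_le k x_ge0; rewrite xk0; lra.
have xkp : 0 < x k by rewrite lt_neqAle eq_sym xk0 x_ge0.
have p01 l : 0 <= x l / x k <= 1 by rewrite divr_ge0 //= ler_pdivrMr // mul1r xk.
have := @ach_EPR_with_partial R N k (enum [set~ k]) (fun l => x l / x k) (x k) N3 p01 (x_ge0 k)
  (enum_uniq _).
rewrite partial_ratio // big_enum_setC1 -(mono_argmax xk'); apply.
by rewrite mem_enum !inE eqxx.
Qed.

Lemma sup_ge_kappaW : sup_ge x (kappaW x).
Proof.
have [k xk] := exists_argmax x (ltn_trans (ltn0Sn 1) N3).
have xk' l : 0 <= x l <= x k by rewrite x_ge0 xk.
rewrite (kappaW_argmax N3 xk').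
have [xk0|xk0] := eqVneq (x k) 0.
  have xz l : x l = 0 by apply/le_anti; rewrite x_ge0 -xk0 xk.
  apply: sup_ge_nonpos; rewrite big1 // add0r -xk0; exact: mono_le.
have xkp : 0 < x k by rewrite lt_neqAle eq_sym xk0 x_ge0.
have p01 l : 0 <= x l / x k <= 1 by rewrite divr_ge0 //= ler_pdivrMr // mul1r xk.
(* Symmetric states of at least two parties lose nothing, hence [D = 0] with all parties as [A]. The
   only loss left is the branch in which all but [k] are dropped, worth x_k times the product of the
   1 - x_l / x_k. *)
have symm (B : {set 'I_N}) (w : R) : k \in B -> B \subset [set: 'I_N] -> 0 <= w ->
    sup_ge (unif B w) (w * (#|B|%:R - (B == [set k])%:R - (B == [set: 'I_N])%:R * 0)).
  move=> kB _ w0; rewrite mulr0 subr0; have [->|Bk] := eqVneq B [set k].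
    by rewrite cards1 subrr mulr0; exact: sup_ge_nonpos.
  rewrite subr0; apply: sup_ge_unif => //.
  rewrite ltn_neqAle card_gt0 andbC; apply/andP; split; first by apply/set0Pn; exists k.
  rewrite eq_sym; apply: contra Bk => /cards1P[j ej].
  by move: kB; rewrite ej inE => /eqP ->.
have := sup_ge_partial p01 symm (L := enum [set~ k]) (B := [set k]) (enum_uniq _) _ _ _ (x_ge0 k).
rewrite partial_ratio // !big_enum_setC1 => h.
apply: sup_ge_le (h _ _ _).
- rewrite eqxx cards1 (mono_argmax xk') mulr0 mul0r subr0 mul1r mulrBr mulrDr mulr1 mulr_sumr.
  have -> : \sum_(l | l != k) x k * (x l / x k) = \sum_(l | l != k) x l.
    by apply: eq_bigr => l _; rewrite mulrC divfK.
  by rewrite addrA [x k + _]addrC.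
- by move=> l; rewrite mem_enum !inE.
- by rewrite inE.
- exact: subsetT.
Qed.

Lemma Wstate_Wvec D : Wstate D x = Wvec D ((Num.sqrt (x0 x))%:C) x.
Proof. by []. Qed.

Lemma ach_Wstate S v : x0 x = 0 -> ach S x v -> exists T : protocol R N 2,
  valid T /\ v%:C <= succ_prob S T (Wstate 0 x).
Proof. by move=> hx; rewrite Wstate_Wvec hx sqrtr0. Qed.

End Conclusion.

Theorem theorem3 (R : realType) (N : nat) (x : 'I_N -> R) :
  (3 <= N)%N -> Wclass x ->
  (* (I) P_tot <= kappaW *)
  (forall (D : nat) (T : protocol R N D.+2), valid T ->
     succ_prob (@EPR_some R N D.+2) T (Wstate D x) <= (kappaW x)%:C) /\
  (* (II) P_k bounds *)
  (forall (k : 'I_N) (D : nat) (T : protocol R N D.+2), valid T ->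
     ((exists l, x k < x l) ->
        succ_prob (EPR_with k) T (Wstate D x) <= (2 * x k)%:C) /\
     ((forall l, x l <= x k) ->
        succ_prob (EPR_with k) T (Wstate D x) <= (2 * etaW x)%:C)) /\
  (x0 x = 0 ->
     (* P_tot = kappaW: the bound (I) is approached arbitrarily closely *)
     (forall eps : R, 0 < eps -> exists (D : nat) (T : protocol R N D.+2),
        valid T /\ ((kappaW x - eps)%:C <= succ_prob (@EPR_some R N D.+2) T (Wstate D x))) /\
     (* the bound (II) is attained exactly *)
     (forall k : 'I_N,
        ((exists l, x k < x l) -> exists (D : nat) (T : protocol R N D.+2),
           valid T /\ succ_prob (EPR_with k) T (Wstate D x) = (2 * x k)%:C) /\
        ((forall l, x l <= x k) -> exists (D : nat) (T : protocol R N D.+2),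
           valid T /\ succ_prob (EPR_with k) T (Wstate D x) = (2 * etaW x)%:C))).
Proof.
move=> N3 [x_ge0 _].
have eta k : (forall l, x l <= x k) -> etaW x = mono k x.
  by move=> xk; apply: etaW_argmax => // l; rewrite x_ge0 xk.
have ub_mono k D (T : protocol R N D.+2) : valid T ->
    succ_prob (EPR_with k) T (Wstate D x) <= (2 * mono k x)%:C.
  by move=> vT; rewrite Wstate_Wvec; exact: succ_prob_EPR_with_le.
have ub k D (T : protocol R N D.+2) : valid T ->
    succ_prob (EPR_with k) T (Wstate D x) <= (2 * x k)%:C.
  by move=> vT; apply: le_trans (ub_mono k D T vT) _; rewrite lecR ler_pM2l // mono_le.
split=> [D T vT|].
  have [k xk] := exists_argmax x (ltn_trans (ltn0Sn 1) N3).
  rewrite Wstate_Wvec; apply: le_trans (succ_prob_EPR_some_le _ x_ge0 vT) _.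
  rewrite lecR (kappaW_argmax (k := k)) // => [|l]; last by rewrite x_ge0 xk.
  (* Only the term of the maximal party is kept as eta; each other one is bounded by its
     coordinate. *)
  by rewrite (bigD1 k) //= addrC lerD2r; apply: ler_sum => l _; exact: mono_le.
split=> [k D T vT|x00].
  by split=> [_|/eta->]; [exact: ub|exact: ub_mono].
split=> [eps eps0|k].
  have [|T hT] := ach_Wstate x00 (sup_ge_kappaW N3 x_ge0 (v := kappaW x - eps) _).
    by rewrite ltrBlDr ltrDl.
  by exists 0, T.
split=> [[l xkl]|xk].
  have kl : k != l by apply: contraTneq xkl => ->; rewrite ltxx.
  have [T [vT hT]] := ach_Wstate x00 (ach_EPR_with N3 kl x_ge0 (ltW xkl)).
  (* The protocol reaches at least the value that bounds every protocol, hence equality. *)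
  by exists 0, T; split=> //; apply/le_anti; rewrite hT ub.
have [T [vT hT]] := ach_Wstate x00 (ach_EPR_with_argmax N3 x_ge0 xk).
by exists 0, T; split=> //; apply/le_anti; rewrite (eta k xk) hT ub_mono.
Qed.
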